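(* Let $k \geq 1$ be an integer. An edgy simplicial set $X$ is lower $(2k-1)$-Segal if and only if the Segal map $\mathscr{E}_n\colon X_n \to \mathbf{W}_k(X)_n$ is surjective for all $n \geq 2k$.
   Context: For a simplicial set $X$ and $n\ge1$, $\mathbf{W}(X)_n=\{(f_1,\dots,f_n)\in X_1^n : d_1(f_i)=d_0(f_{i-1})\text{ for }2\le i\le n\}$ is the set of words of length $n$ with edges agreeing target to source. The Segal map $\mathscr{E}_n\colon X_n\to\mathbf{W}(X)_n$ sends $x$ to $(\epsilon_{01}^*x,\epsilon_{12}^*x,\dots,\epsilon_{n-1,n}^*x)$, where $\epsilon_{ij}\colon[1]\to[n]$ sends $0\mapsto i$, $1\mapsto j$. $X$ is edgy if $\mathscr{E}_n$ is injective for all $n\ge1$; one then writes $[f_1|\cdots|f_n]$ for the element of $X_n$ with image $(f_1,\dots,f_n)$, and $[f_1|\cdots|f_n]\in X_n$ means that such an element exists. If $[f|g]\in X_2$, put $g\circ f=d_1[f|g]$. Partially defined faces of words: for $w=(f_1,\dots,f_n)\in\mathbf{W}(X)_n$, $n\ge2$, $d_0(w)=(f_2,\dots,f_n)$ and $d_n(w)=(f_1,\dots,f_{n-1})$; for $1\le i\le n-1$, $d_i(w)$ is defined if $[f_i|f_{i+1}]\in X_2$, and then $d_i(w)=(f_1,\dots,f_{i-1},f_{i+1}\circ f_i,f_{i+2},\dots,f_n)$. A subset $I\subset[n]=\{0,\dots,n\}$ is gapped if distinct elements of $I$ differ by at least $2$. For gapped $I\subset[n]$, $\mathbf{W}_I(X)_n$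 is the set of words $w\in\mathbf{W}(X)_n$ such that for each $i\in I$, $d_i(w)$ is defined and in the image of $\mathscr{E}_{n-1}$. $\mathbf{W}_k(X)_n$ is the union of $\mathbf{W}_I(X)_n$ over the gapped subsets $I\subset[n]$ of cardinality $k+1$. For $n\ge 2k$, $\mathscr{E}_n$ has image in $\mathbf{W}_k(X)_n$. For $k\ge1$, a simplicial set $X$ is lower $(2k-1)$-Segal if for every $n$ and every gapped $I\subset[n]$ of cardinality $k+1$, the cube $J\mapsto X_{[n]\setminus J}$ ($J\subseteq I$) is a limit diagram; i.e., for every family $(x_i)_{i\in I}$ in $X_{n-1}$ with $d_ix_j=d_{j-1}x_i$ for all $i<j$ in $I$, there is a unique $x\in X_n$ with $d_ix=x_i$ for all $i\in I$. *)

(* Defs.v *)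
From HB Require Import structures.
From mathcomp Require Import all_boot.

Set Implicit Arguments.
Unset Strict Implicit.
Unset Printing Implicit Defensive.

(* [simp m n] is the set of morphisms [m] -> [n] of the simplex category;
   the object [n] = {0, ..., n} is the type 'I_n.+1. *)
Definition monotone m n (a : {ffun 'I_m -> 'I_n}) : bool :=
  [forall i : 'I_m, forall j : 'I_m, (i <= j) ==> (a i <= a j)].

Record simp (m n : nat) := Simp {
  simp_fun :> {ffun 'I_m.+1 -> 'I_n.+1};
  simp_mono : monotone simp_fun }.

HB.instance Definition _ m n := [isSub for @simp_fun m n].

Lemma monotoneP m n (a : {ffun 'I_m -> 'I_n}) :
  reflect (forall i j : 'I_m, i <= j -> a i <= a j) (monotone a).
Proof.
apply: (iffP forallP) => [H i j ij|H i]; first exact: implyP (forallP (H i) j) ij.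
by apply/forallP => j; apply/implyP/H.
Qed.

Fact simp_id_subproof n : monotone [ffun i : 'I_n.+1 => i].
Proof. by apply/monotoneP => i j; rewrite !ffunE. Qed.

Definition simp_id n : simp n n := Simp (simp_id_subproof n).

Fact simp_comp_subproof m n p (b : simp n p) (a : simp m n) :
  monotone [ffun i : 'I_m.+1 => b (a i)].
Proof.
apply/monotoneP => i j ij; rewrite !ffunE.
by apply: (monotoneP _ (simp_mono b)); apply: (monotoneP _ (simp_mono a)).
Qed.

Definition simp_comp m n p (b : simp n p) (a : simp m n) : simp m p :=
  Simp (simp_comp_subproof b a).

Record sset := SSet {
  sset_ob :> nat -> Type;
  pull : forall m n, simp m n -> sset_ob n -> sset_ob m;
  pull_id : forall n (x : sset_ob n), pull (simp_id n) x = x;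
  pull_comp : forall m n p (b : simp n p) (a : simp m n) (x : sset_ob p),
    pull (simp_comp b a) x = pull a (pull b x) }.

Fact coface_lt n i (j : 'I_n.+1) : bump i j < n.+2.
Proof. by rewrite /bump; case: (i <= j); rewrite !ltnS ?add0n ?leq_ord // ltnW // ltnS leq_ord. Qed.

Fact coface_subproof n i :
  monotone [ffun j : 'I_n.+1 => Ordinal (coface_lt i j)].
Proof. by apply/monotoneP => j l; rewrite !ffunE /= leq_bump2. Qed.

(* The injection [n] -> [n+1] omitting i. The index is a natural number, so
   that no cast is needed in d_i d_j = d_(j-1) d_i; only the values i <= n+1
   are meaningful, and only these are used. *)
Definition coface n (i : nat) : simp n n.+1 := Simp (coface_subproof n i).

Definition face (X : sset) n (i : nat) (x : X n.+1) : X n :=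
  pull (coface n i) x.

Fact eps_subproof n (i j : 'I_n.+1) : i <= j ->
  monotone [ffun l : 'I_2 => if l == ord0 then i else j].
Proof.
move=> ij; apply/monotoneP => l l'; rewrite !ffunE -!val_eqE /=.
by case: eqVneq => [_|l0]; case: eqVneq => // ->; rewrite leqn0 (negPf l0).
Qed.

Definition eps n (i j : 'I_n.+1) (ij : i <= j) : simp 1 n :=
  Simp (eps_subproof ij).

Fact spine_subproof n (i : 'I_n) : widen_ord (leqnSn n) i <= lift ord0 i.
Proof. exact: leqnSn. Qed.

(* Letters are indexed from 0 in the tuple: its entry i is the pullback along
   the edge i -> i+1. *)
Definition segal (X : sset) n (x : X n) : n.-tuple (X 1) :=
  [tuple pull (eps (spine_subproof i)) x | i < n].

Definition edgy (X : sset) : Prop :=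
  forall n, 1 <= n -> injective (@segal X n).

Definition word (X : sset) n (w : n.-tuple (X 1)) : Prop :=
  forall i j : 'I_n, j = i.+1 :> nat ->
    face 1 (tnth w j) = face 0 (tnth w i).

(* "[f|g] is in X_2 and g o f = h"; for edgy X, h is determined by f and g. *)
Definition composite (X : sset) (f g h : X 1) : Prop :=
  exists2 x : X 2, segal x = [tuple f; g] & face 1 x = h.

(* "d_i(w) is defined and equal to w'", for words w of length n >= 2 and
   0 <= i <= n. *)
Definition word_face (X : sset) n (i : nat)
    (w : n.-tuple (X 1)) (w' : n.-1.-tuple (X 1)) : Prop :=
  if i == 0 then w' = behead w :> seq (X 1)
  else if i == n then w' = take n.-1 w :> seq (X 1)
  else exists s f g t h, [/\ size s = i.-1,
         w = s ++ [:: f, g & t] :> seq (X 1),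
         composite f g h
       & w' = s ++ h :: t :> seq (X 1)].

Definition gapped n (I : {set 'I_n}) : Prop :=
  forall i j : 'I_n, i \in I -> j \in I -> i < j -> i.+2 <= j.

(* [word_on I] is W_I(X)_n and [word_deg k] is W_k(X)_n. *)
Definition word_on (X : sset) n (I : {set 'I_n.+1})
    (w : n.-tuple (X 1)) : Prop :=
  word w /\
  forall i, i \in I ->
    exists2 w', word_face i w w' & exists y : X n.-1, segal y = w'.

Definition word_deg (X : sset) (k n : nat) (w : n.-tuple (X 1)) : Prop :=
  exists I : {set 'I_n.+1}, [/\ gapped I, #|I| = k.+1 & word_on I w].

(* [lower_segal k] is the lower (2k-1)-Segal condition, for k >= 1. A gapped
   subset of [m] with k+1 >= 2 elements exists only if m >= 2, whence the
   quantification over m = n+2. *)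
Definition lower_segal (k : nat) (X : sset) : Prop :=
  forall n (I : {set 'I_n.+3}), gapped I -> #|I| = k.+1 ->
  forall x : {i : 'I_n.+3 | i \in I} -> X n.+1,
    (forall i j : {i : 'I_n.+3 | i \in I}, val i < val j ->
       face (val i) (x j) = face (val j).-1 (x i)) ->
  exists! y : X n.+2, forall i : {i : 'I_n.+3 | i \in I}, face (val i) y = x i.

(* Main.v *)
(* A gapped set I with at least two elements has, for every edge l -> l+1 and
   for every i in I, a member away from that edge, resp. from i-1, i, i+1.
   Hence a matching family (x_i) determines a word, and each of its inner
   composites at i is witnessed by a triangle in some other x_j; a simplex with
   this spine then has the x_i as faces, by edginess. Conversely the faces d_i(w)
   of a word in W_I(X)_n are spines of simplices x_i, which match because word
   faces satisfy the simplicial identities d_i d_j = d_(j-1) d_i; a filler has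
   the same edges as w, since each edge lies in some d_i. *)
Require Import Defs.
From mathcomp Require Import all_boot zify.

Set Implicit Arguments.
Unset Strict Implicit.
Unset Printing Implicit Defensive.

(** * Operators of the simplex category: windows, cofaces and their retractions *)

Lemma simp_ext m n (a b : simp m n) : (forall j, a j = b j :> nat) -> a = b.
Proof. by move=> ab; apply/val_inj/ffunP => j; apply/val_inj/ab. Qed.

Lemma compE m n p (b : simp n p) (a : simp m n) j : simp_comp b a j = b (a j).
Proof. by rewrite ffunE. Qed.

Lemma cofaceE n i (j : 'I_n.+1) : coface n i j = bump i j :> nat.
Proof. by rewrite ffunE. Qed.

Fact window_subproof m n p :
  monotone [ffun j : 'I_m.+1 => inord (minn n (p + j)) : 'I_n.+1].
Proof. by apply/monotoneP => j l jl; rewrite !ffunE !inordK; lia. Qed.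

(* The truncation at n only makes the map total; it is used for p + m <= n. *)
Definition window m n p : simp m n := Simp (window_subproof m n p).

Lemma windowE m n p (j : 'I_m.+1) : window m n p j = minn n (p + j) :> nat.
Proof. by rewrite ffunE inordK //; lia. Qed.

Fact codeg_subproof n i :
  monotone [ffun j : 'I_n.+2 => inord (minn n (unbump i j)) : 'I_n.+1].
Proof.
by apply/monotoneP => j l jl; rewrite !ffunE !inordK /unbump; lia.
Qed.

(* A retraction of [coface n i]; it is s_i for i <= n and s_n for i = n+1. *)
Definition codeg n i : simp n.+1 n := Simp (codeg_subproof n i).

Lemma codegE n i (j : 'I_n.+2) : codeg n i j = minn n (unbump i j) :> nat.
Proof. by rewrite ffunE inordK //; lia. Qed.

Lemma window_comp m n p q r : r + m <= n ->
  simp_comp (window n p q) (window m n r) = window m p (q + r).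
Proof.
by move=> le_n; apply: simp_ext => j; rewrite compE !windowE; have := ltn_ord j; lia.
Qed.

Lemma window_id n : window n n 0 = simp_id n.
Proof.
by apply: simp_ext => j; rewrite windowE ffunE; have := ltn_ord j; lia.
Qed.

Lemma coface0_window n p :
  simp_comp (window 1 n p) (coface 0 0) = window 0 n p.+1.
Proof.
by apply: simp_ext => j; rewrite compE !windowE cofaceE /bump; have := ltn_ord j; lia.
Qed.

Lemma coface1_window n p :
  simp_comp (window 1 n p) (coface 0 1) = window 0 n p.
Proof.
by apply: simp_ext => j; rewrite compE !windowE cofaceE /bump; have := ltn_ord j; lia.
Qed.

Lemma window_before_coface n i l : l.+1 < i -> l < n ->
  simp_comp (coface n i) (window 1 n l) = window 1 n.+1 l.
Proof.
move=> li ln; apply: simp_ext => j.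
by rewrite compE cofaceE !windowE /bump; have := ltn_ord j; lia.
Qed.

Lemma window_after_coface n i l : i <= l -> l < n ->
  simp_comp (coface n i) (window 1 n l) = window 1 n.+1 l.+1.
Proof.
move=> li ln; apply: simp_ext => j.
by rewrite compE cofaceE !windowE /bump; have := ltn_ord j; lia.
Qed.

Lemma window_across_coface n l : l < n ->
  simp_comp (coface n l.+1) (window 1 n l) =
  simp_comp (window 2 n.+1 l) (coface 1 1).
Proof.
move=> ln; apply: simp_ext => j.
by rewrite !compE cofaceE !windowE cofaceE /bump; have := ltn_ord j; lia.
Qed.

Lemma codeg_coface n i : i <= n.+1 ->
  simp_comp (codeg n i) (coface n i) = simp_id n.
Proof.
move=> le_i; apply: simp_ext => j.
by rewrite compE codegE cofaceE ffunE bumpK; have := ltn_ord j; lia.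
Qed.

Lemma coface_comp n i j : i < j ->
  simp_comp (coface n.+1 j) (coface n i) =
  simp_comp (coface n.+1 i) (coface n j.-1).
Proof.
by move=> ij; apply: simp_ext => l; rewrite !compE !cofaceE /bump; lia.
Qed.

(** * Operators omitting a vertex, and agreement on common faces *)

Definition misses m n (a : simp m n) (i : nat) := forall l, a l <> i :> nat.

(** Away from the value [i], [codeg n i] is inverse to [coface n i]. *)
Lemma misses_factor m n i (a : simp m n.+1) : i <= n.+1 -> misses a i ->
  simp_comp (coface n i) (simp_comp (codeg n i) a) = a.
Proof.
move=> le_i ai; apply: simp_ext => l.
rewrite !compE cofaceE codegE /bump /unbump.
by have := ai l; have := ltn_ord (a l); lia.
Qed.

Lemma misses_window m n p i : p + m <= n -> (i < p) || (p + m < i) ->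
  misses (window m n p) i.
Proof.
by move=> pn out l; rewrite windowE; have := ltn_ord l; lia.
Qed.

Lemma face_codeg (X : sset) n i (x : X n) : i <= n.+1 ->
  face i (pull (codeg n i) x) = x.
Proof. by move=> le_i; rewrite /face -pull_comp codeg_coface // pull_id. Qed.

(** An operator omitting both values factors through the codimension-two face opposite [i] and [j],
    where the hypothesis makes [x] and [y] coincide. *)
Lemma face_pull_agree (X : sset) m n i j (a : simp m n.+2) (x y : X n.+2) :
    i < j -> j <= n.+2 -> face i (face j y) = face j.-1 (face i x) ->
    misses a i -> misses a j ->
  pull a x = pull a y.
Proof.
move=> ij jn agree ai aj; set b := simp_comp (codeg n.+1 j) a.
have def_a : simp_comp (coface n.+1 j) b = a by apply: misses_factor.
have bi : misses b i.
  move=> l bl; apply: (ai l).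
  by rewrite -def_a compE cofaceE bl /bump; lia.
have def_b : simp_comp (coface n i) (simp_comp (codeg n i) b) = b.
  by apply: misses_factor => //; lia.
rewrite -def_a -def_b [in RHS]pull_comp [in RHS]pull_comp -!/(face _ _) agree.
rewrite /face -!pull_comp; congr pull.
apply: simp_ext => l; rewrite !compE.
have /(congr1 (fun f : simp n n.+2 => f (codeg n i (b l)))) := coface_comp n ij.
by rewrite !compE => ->.
Qed.

(** * Spines of simplices *)

Lemma nth_segal (X : sset) n x0 (x : X n) l : l < n ->
  nth x0 (segal x) l = pull (window 1 n l) x.
Proof.
move=> ln; rewrite -[l]/(val (Ordinal ln)) -tnth_nth tnth_mktuple; congr pull.
apply: simp_ext => j; rewrite windowE ffunE -val_eqE /=.
by case: j => [[|[|//]]] /= _; rewrite /bump; lia.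
Qed.

Lemma tuple_nthP (T : Type) n x0 (s t : n.-tuple T) :
  (forall l, l < n -> nth x0 s l = nth x0 t l) -> s = t.
Proof.
move=> st; apply/val_inj/(@eq_from_nth _ x0) => [|l]; rewrite !size_tuple //.
by move/st.
Qed.

Lemma segal1 (X : sset) (x : X 1) : segal x = [tuple x].
Proof.
apply: (@tuple_nthP _ _ x) => -[|//] _.
by rewrite nth_segal // window_id pull_id.
Qed.

Lemma segal_window2 (X : sset) n p (x : X n) : p.+1 < n ->
  segal (pull (window 2 n p) x) =
  [tuple pull (window 1 n p) x; pull (window 1 n p.+1) x].
Proof.
move=> pn; have x0 := pull (window 1 n p) x.
apply: (@tuple_nthP _ _ x0) => -[|[|//]] _;
by rewrite nth_segal // -pull_comp window_comp // ?addn0 ?addn1.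
Qed.

(** * Faces of words *)

Lemma composite_fun (X : sset) (f g h h' : X 1) : edgy X ->
  composite f g h -> composite f g h' -> h = h'.
Proof.
move=> eX [x sx <-] [y sy <-]; congr face.
by apply: (eX 2 isT); rewrite sx sy.
Qed.

(** Letterwise, the three cases of the definition merge: the composite clause is void at the two
    outer faces. Indices past the end give [x0] on both sides, so the second clause is unbounded in
    [l]. *)
Lemma word_faceP (X : sset) n x0 i (w : n.+2.-tuple (X 1))
    (w' : n.+1.-tuple (X 1)) : i <= n.+2 ->
  word_face i w w' <->
  [/\ forall l, l.+1 < i -> nth x0 w' l = nth x0 w l,
      forall l, i <= l -> nth x0 w' l = nth x0 w l.+1
    & 0 < i < n.+2 ->
        composite (nth x0 w i.-1) (nth x0 w i) (nth x0 w' i.-1)].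
Proof.
move=> le_i; have sw := size_tuple w; have sw' := size_tuple w'.
rewrite /word_face; case: eqVneq => [->|i0].
  split=> [->|[_ after _]].
    by split=> // l _; rewrite nth_behead.
  apply: (@eq_from_nth _ x0) => [|l _]; first by rewrite size_behead sw sw'.
  by rewrite nth_behead after.
case: eqVneq => [->|iN].
  split=> [->|[before _ _]].
    split=> [l ln|l ln|]; first by rewrite nth_take.
    - by rewrite !nth_default ?size_takel ?sw //= ltnW.
    - by rewrite ltnn andbF.
  apply: (@eq_from_nth _ x0) => [|l]; rewrite ?size_take ?sw ?sw' /= ?ltnS ?leqnn //.
  by move=> ln; rewrite nth_take // before.
split=> [[s [f [g [t [h [ss -> fg ->]]]]]]|[before after comp]].
  split=> [l li|l li|_]; rewrite !nth_cat ss.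
  - by have -> : l < i.-1 by lia.
  - have -> : (l < i.-1) = false by lia.
    have -> : (l.+1 < i.-1) = false by lia.
    have -> : l.+1 - i.-1 = (l - i).+2 by lia.
    by have -> : l - i.-1 = (l - i).+1 by lia.
  - have -> : (i < i.-1) = false by lia.
    have -> : i - i.-1 = 1 by lia.
    by rewrite ltnn subnn.
exists (take i.-1 w), (nth x0 w i.-1), (nth x0 w i), (drop i.+1 w).
exists (nth x0 w' i.-1).
have iw : i < size w by lia.
have st : size (take i.-1 w) = i.-1 by rewrite size_take; case: ifP; lia.
split=> //.
- rewrite -{1}(cat_take_drop i.-1 w) (drop_nth x0); last by lia.
  by rewrite prednK ?lt0n // (drop_nth x0 iw).
- by apply: comp; lia.
apply: (@eq_from_nth _ x0) => [|l ln].
  by rewrite size_cat /= size_drop st; lia.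
rewrite nth_cat st; case: ltnP => [li|li].
  by rewrite nth_take // before //; lia.
have [->|li'] := eqVneq l i.-1; first by rewrite subnn.
rewrite (after l); last by lia.
have -> : l - i.-1 = (l - i).+1 by lia.
rewrite /= nth_drop; congr nth; lia.
Qed.

Lemma word_face_fun (X : sset) n i (w : n.+2.-tuple (X 1))
    (u v : n.+1.-tuple (X 1)) : edgy X -> i <= n.+2 ->
  word_face i w u -> word_face i w v -> u = v.
Proof.
move=> eX le_i; have x0 := tnth w ord0.
move=> /(word_faceP x0 _ _ le_i)[u1 u2 u3] /(word_faceP x0 _ _ le_i)[v1 v2 v3].
apply: (@tuple_nthP _ _ x0) => l ln.
case: (ltngtP l.+1 i) => li; first by rewrite u1 ?v1.
  by rewrite u2 ?v2.
have li' : 0 < i < n.+2 by lia.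
by have := composite_fun eX (u3 li') (v3 li'); rewrite -li.
Qed.

(** As [i.+2 <= j], the letter pairs composed at [i] and at [j] are disjoint, so the two operations
    act on different letters; edginess makes the composites single-valued. *)
Lemma word_face_comm (X : sset) n i j (w : n.+3.-tuple (X 1))
    (u v : n.+2.-tuple (X 1)) (u' v' : n.+1.-tuple (X 1)) :
    edgy X -> i.+2 <= j -> j <= n.+3 ->
    word_face j w u -> word_face i w v ->
    word_face i u u' -> word_face j.-1 v v' ->
  u' = v'.
Proof.
move=> eX ij jn; have x0 := tnth w ord0.
have in3 : i <= n.+3 by lia.
have in2 : i <= n.+2 by lia.
have jn2 : j.-1 <= n.+2 by lia.
move=> /(word_faceP x0 _ _ jn)[u1 u2 u3] /(word_faceP x0 _ _ in3)[v1 v2 v3].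
move=> /(word_faceP x0 _ _ in2)[u1' u2' u3'].
move=> /(word_faceP x0 _ _ jn2)[v1' v2' v3'].
apply: (@tuple_nthP _ _ x0) => l ln.
case: (ltngtP l.+1 i) => li.
- by rewrite u1' ?v1' ?u1 ?v1 //; lia.
(* The face at [i] shifts later letters down by one, so the composite at [j] becomes letter [l] of
   the final word when [l.+2 = j]. *)
- rewrite u2' //; case: (ltngtP l.+2 j) => lj.
  + by rewrite v1' ?u1 ?v2 //; lia.
  + by rewrite v2' ?u2 ?v2 //; lia.
  + have jr : 0 < j < n.+3 by lia.
    have jr' : 0 < j.-1 < n.+2 by lia.
    move: (u3 jr) (v3' jr'); rewrite -lj /=.
    by rewrite !v2; [exact: composite_fun | lia..].
- have ir : 0 < i < n.+3 by lia.
  have ir' : 0 < i < n.+2 by lia.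
  rewrite v1'; last by lia.
  move: (u3' ir') (v3 ir); rewrite -li /=.
  by rewrite !u1; [exact: composite_fun | lia..].
Qed.

Lemma segal_word_face (X : sset) n i (x : X n.+2) : i <= n.+2 ->
  word_face i (segal x) (segal (face i x)).
Proof.
move=> le_i; have x0 := tnth (segal x) ord0.
apply/(word_faceP x0 _ _ le_i); split=> [l li|l li|].
- by rewrite !nth_segal /face -?pull_comp ?window_before_coface //; lia.
- case: (ltnP l n.+1) => ln; last by rewrite !nth_default ?size_tuple.
  by rewrite !nth_segal /face -?pull_comp ?window_after_coface //; lia.
(* With the omitted vertex now [i.+1], the triangle on [i], [i.+1], [i.+2] witnesses the
   composite. *)
case: i le_i => // i _ /= ilt; exists (pull (window 2 n.+2 i) x).
  by rewrite segal_window2 ?nth_segal //; lia.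
rewrite nth_segal /face -?pull_comp; last by lia.
by rewrite window_across_coface //; lia.
Qed.

(** In positive degree both sides have the same spine, so edginess identifies them. In degree zero
    they are the target of the first letter and the source of the second, equated by [word w]. *)
Lemma word_face_matching (X : sset) n i j (w : n.+2.-tuple (X 1))
    (x y : X n.+1) :
    edgy X -> word w -> i.+2 <= j -> j <= n.+2 ->
    word_face j w (segal x) -> word_face i w (segal y) ->
  face i x = face j.-1 y.
Proof.
case: n w x y => [|n] w x y eX ww ij jn wx wy; last first.
  by apply: (eX n.+1 isT); apply: (word_face_comm eX ij jn wx wy);
    apply: segal_word_face; lia.
have x0 := tnth w ord0; have i_le : i <= 2 by lia.
have /(word_faceP x0 _ _ jn)[/(_ 0) + _ _] := wx.
have /(word_faceP x0 _ _ i_le)[_ /(_ 0) + _] := wy.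
have [-> ->] : i = 0 /\ j = 2 by lia.
rewrite !segal1 /= => -> // -> //.
by have := ww ord0 (lift ord0 ord0) erefl; rewrite !(tnth_nth x0).
Qed.

(** * Members of a gapped set *)

(** Halving is injective on a gapped set and takes values in [0, ..., n./2]. *)
Lemma gapped_card n k (I : {set 'I_n.+1}) :
  gapped I -> #|I| = k.+1 -> 2 * k <= n.
Proof.
move=> gI cI; pose h (i : 'I_n.+1) : 'I_(n./2.+1) := inord i./2.
have hE i : h i = i./2 :> nat by rewrite inordK //; have := ltn_ord i; lia.
have h_inj : {in I &, injective h}.
  move=> i j iI jI /(congr1 val); rewrite /= !hE => hij; apply: val_inj => /=.
  by case: (ltngtP i j) => // [/(gI _ _ iI jI)|/(gI _ _ jI iI)]; lia.
have := max_card (mem (h @: I)).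
by rewrite card_in_imset // cI card_ord; lia.
Qed.

Lemma gapped_other n (I : {set 'I_n}) (i : 'I_n) : gapped I -> 1 < #|I| ->
  i \in I -> exists2 j, j \in I & (i.+1 < j) || (j.+1 < i).
Proof.
move=> gI /card_gt1P[a [b [aI bI]]] ab iI.
have [j jI ji] : exists2 j, j \in I & j != i.
  by case: (eqVneq a i) ab => [<-|ai _]; [exists b; rewrite // eq_sym | exists a].
exists j => //; rewrite -val_eqE /= in ji.
by case: (ltngtP j i) ji => // [/(gI _ _ jI iI)|/(gI _ _ iI jI)]; lia.
Qed.

(** At most one end of the edge from [l] to [l.+1] lies in [I], and any other member avoids the
    edge. *)
Lemma gapped_off_edge n (I : {set 'I_n}) l : gapped I -> 1 < #|I| ->
  exists2 i : 'I_n, i \in I & (i < l) || (l.+1 < i).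
Proof.
move=> gI cI; have /card_gt0P[i iI] : 0 < #|I| by lia.
have [j jI ij] := gapped_other gI cI iI.
case: (boolP ((i < l) || (l.+1 < i))) => [|io]; first by exists i.
by exists j => //; lia.
Qed.

(** * From the Segal condition to surjectivity, and back *)

Lemma lower_segal_spine_surj (k : nat) (X : sset) n (w : n.-tuple (X 1)) :
    1 <= k -> edgy X -> lower_segal k X -> 2 * k <= n -> word_deg k w ->
  exists x : X n, segal x = w.
Proof.
move=> hk eX lX; case: n w => [|[|n]] w kn [I [gI cI [ww wI]]]; [lia..|].
have bd (i : 'I_n.+3) : i <= n.+2 by rewrite -ltnS.
have /fin_all_exists[x xP] (i : {i | i \in I}) :
    exists x : X n.+1, word_face (val i) w (segal x).
  by have [w' fw [y yw]] := wI _ (valP i); exists y; rewrite yw.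
have [|y [yx _]] := lX n I gI cI x.
  move=> i j ij; apply: (word_face_matching eX ww _ _ (xP j) (xP i)) => //.
  exact: gI (valP i) (valP j) ij.
exists y; have x0 := tnth w ord0.
apply: (@tuple_nthP _ _ x0) => l ln.
have cI1 : 1 < #|I| by rewrite cI.
have [i iI il] := gapped_off_edge l gI cI1.
have fw := xP (exist _ i iI); have fy := segal_word_face y (bd i).
rewrite (yx (exist _ i iI)) /= in fy.
have /(word_faceP x0 _ _ (bd i))[w1 w2 _] := fw.
have /(word_faceP x0 _ _ (bd i))[y1 y2 _] := fy.
(* The edge [l] survives in the face at [i]: as letter [l.-1] if [i < l], as letter [l] if [i] lies
   beyond it. *)
case/orP: il => il; last by rewrite -y1 ?w1.
by case: l il ln => // l il ln; rewrite -y2 ?w2.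
Qed.

Lemma lower_segal_of_spine_surj (k : nat) (X : sset) : 1 <= k -> edgy X ->
  (forall n, 2 * k <= n -> forall w : n.-tuple (X 1), word_deg k w ->
     exists x : X n, segal x = w) ->
  lower_segal k X.
Proof.
move=> hk eX surj n I gI cI x compat.
have cI1 : 1 < #|I| by rewrite cI.
pose T := {i : 'I_n.+3 | i \in I}.
(* An opaque copy of [val], so that arithmetic treats each [v i] as an atom. *)
have [v vE] : exists v : T -> nat, forall i, v i = val i by exists val.
have v_inj : injective v by move=> i j; rewrite !vE => /val_inj/val_inj.
have bd i : v i <= n.+2 by rewrite vE -ltnS.
have other i : exists j, ((v i).+1 < v j) || ((v j).+1 < v i).
  have [j jI ij] := gapped_other gI cI1 (valP i).
  by exists (exist _ j jI); rewrite !vE.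
have off l : exists i, (v i < l) || (l.+1 < v i).
  by have [i iI il] := gapped_off_edge l gI cI1; exists (exist _ i iI); rewrite vE.
have {}compat i j : v i < v j -> face (v i) (x j) = face (v j).-1 (x i).
  by rewrite !vE; apply: compat.
(* Degenerate lifts: the x_i become elements z_i of a single set, and matching
   says that z_i and z_j agree on all faces omitting both i and j. *)
have [z fz] : exists z : T -> X n.+2, forall i, face (v i) (z i) = x i.
  by exists (fun i => pull (codeg n.+1 (v i)) (x i)) => i; apply: face_codeg.
have agree m (a : simp m n.+2) i j : misses a (v i) -> misses a (v j) ->
    pull a (z i) = pull a (z j).
  move=> ai aj; case: (ltngtP (v i) (v j)) => [ij|ji|/v_inj -> //].
  - by apply: (face_pull_agree ij) => //; rewrite !fz compat.
  - by apply/esym/(face_pull_agree ji) => //; rewrite !fz compat.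
have /fin_all_exists[c cP] (l : 'I_n.+2) := off l.
(* Letter [l] is taken from a lift whose index avoids that edge; by [agree], every such lift gives
   the same letter. *)
pose w := [tuple pull (window 1 n.+2 l) (z (c l)) | l < n.+2].
have x0 := tnth w ord0.
have nth_w l i : l < n.+2 -> (v i < l) || (l.+1 < v i) ->
    nth x0 w l = pull (window 1 n.+2 l) (z i).
  move=> ln il; rewrite -[l in LHS]/(val (Ordinal ln)) -tnth_nth tnth_mktuple.
  have := cP (Ordinal ln) => /= cl.
  by apply: agree; apply: misses_window; lia.
have face_w i : word_face (v i) w (segal (x i)).
  have := segal_word_face (z i) (bd i); rewrite fz.
  move=> /(word_faceP x0 _ _ (bd _))[b1 b2 _].
  apply/(word_faceP x0 _ _ (bd _)); split=> [l li|l li|ir].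
  - have ln : l < n.+2 by have := bd i; lia.
    by rewrite b1 // (@nth_w l i) ?nth_segal //; lia.
  - case: (ltnP l n.+1) => ln; last by rewrite !nth_default ?size_tuple.
    by rewrite b2 // (@nth_w l.+1 i) ?nth_segal //; lia.
  (* The triangle around [v i] is taken in [z j], with [v j] off all three vertices. Its long edge
     omits [v i] and [v j], so it is also an edge of [z i], hence a letter of [x i]. *)
  - have [j ij] := other i.
    have [p pE] : exists p, v i = p.+1 by exists (v i).-1; lia.
    rewrite pE /= (@nth_w _ j) ?(@nth_w p.+1 j); [|lia..].
    exists (pull (window 2 n.+2 p) (z j)); first by rewrite segal_window2 //; lia.
    have pn : p < n.+1 by lia.
    rewrite nth_segal // -(fz i) /face -!pull_comp pE window_across_coface //.
    by apply: agree => l; rewrite compE windowE cofaceE /bump /=;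
      have := ltn_ord l; lia.
(* For uniqueness: each edge of a filler omits some [v i], hence is determined by [x i]. *)
have segal_w (y : X n.+2) : (forall i, face (v i) y = x i) -> segal y = w.
  move=> fy; apply: (@tuple_nthP _ _ x0) => l ln.
  have [i il] := off l; rewrite nth_segal // (nth_w l i) //.
  have /misses_factor <- // : misses (window 1 n.+2 l) (v i).
    by apply: misses_window; lia.
  by rewrite !pull_comp -!/(face _ _) fy fz.
have [||y yw] := surj n.+2 _ w.
- exact: gapped_card gI cI.
- exists I; split=> //; split=> [l l' ll'|i iI].
    (* Consecutive letters may come from different lifts, but their common vertex omits both
       indices. *)
    rewrite !tnth_mktuple /face -!pull_comp coface0_window coface1_window ll'.
    have := cP l; have := cP l'; have := ltn_ord l'.
    by rewrite ll' => ? ? ?; apply: agree; apply: misses_window; lia.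
  exists (segal (x (exist _ i iI))); last by exists (x (exist _ i iI)).
  by have := face_w (exist _ i iI); rewrite vE.
exists y; split=> [i|y' fy'].
  (* Both simplices have as spine the face of [w] at [v i]. *)
  apply: (eX n.+1 isT); rewrite -vE.
  by apply: (word_face_fun eX (bd i) _ (face_w i)); rewrite -yw; apply: segal_word_face.
by apply: (eX n.+2 isT); rewrite yw segal_w // => i; rewrite vE.
Qed.

Theorem theorem4p4 (k : nat) (hk : 1 <= k) (X : sset) (hX : edgy X) :
  lower_segal k X <->
  (forall n, 2 * k <= n ->
     forall w : n.-tuple (X 1), word_deg k w ->
       exists x : X n, segal x = w).
Proof.
split=> [lX n kn w|]; first exact: lower_segal_spine_surj.
exact: lower_segal_of_spine_surj.
Qed.
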